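(* Let $A$ be a unital Banach algebra and let $\alpha:A\to A$ be a contractive endomorphism. Then there is a Banach space $E$, a unital isometric homomorphism $\pi:A\to\mathcal{B}(E)$ and mutually adjoint partial isometries $S,T\in\mathcal{B}(E)$ such that $$\pi(\alpha(a))=T\pi(a)S\quad\text{for }a\in A,\qquad\text{and}\qquad ST\in\pi(A)'.$$ Thus for each $a\in A$ the operator $\pi(a)T$ is an abstract weighted shift associated with the endomorphism (isometrically conjugated with) $\alpha$.
   Context: For a Banach space $E$, operators $T,S\in\mathcal{B}(E)$ are called mutually adjoint partial isometries if both are contractions and $TST=T$, $STS=S$. For $M\subseteq\mathcal{B}(E)$, $M'$ denotes the commutant of $M$ in $\mathcal{B}(E)$. Given a subalgebra $A\subseteq\mathcal{B}(E)$ containing $1\in\mathcal{B}(E)$ and mutually adjoint partial isometries $T,S\in\mathcal{B}(E)$ with $TAS\subseteq A$ and $ST\in A'$, the map $\alpha(a)=TaS$ is an endomorphism of $A$, and the operators $aT$, $a\in A$, are called (abstract) weighted shift operators associated with the endomorphism $\alpha$. *)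

(* Defs.v *)
From HB Require Import structures.
From mathcomp Require Import all_boot all_order all_algebra.
From mathcomp Require Import all_classical all_reals all_analysis.
From mathcomp Require Import complex.

Set Implicit Arguments.
Unset Strict Implicit.
Unset Printing Implicit Defensive.

Import Order.TTheory GRing.Theory Num.Theory.
Import numFieldNormedType.Exports.

Local Open Scope classical_set_scope.
Local Open Scope ring_scope.

Variant scalar_kind := RealScalars | ComplexScalars.

Definition scalars (R : realType) (k : scalar_kind) : numFieldType :=
  match k with
  | RealScalars => R
  | ComplexScalars => R[i]
  end.

(* The norm of a [normedModType K] takes its values in K; over [R[i]] the order
   is the one whose nonnegative elements are the nonnegative reals, so norms
   are real and [`|x| <= `|y|] has its usual meaning.

   This is a record rather than a join of [algType] and [completeNormedModType]
   because Hierarchy Builder refuses structures that inherit from a ring and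
   from a normed module declared after [numDomainType]; both structures are
   put on the carrier by instances below. *)
Record unitalBanachAlgType (K : numFieldType) : Type := UnitalBanachAlgebra {
  banach_space : completeNormedModType K;
  banach_one : banach_space;
  banach_mul : banach_space -> banach_space -> banach_space;
  banach_mulA : associative banach_mul;
  banach_mul1l : left_id banach_one banach_mul;
  banach_mul1r : right_id banach_one banach_mul;
  banach_mulDl : left_distributive banach_mul +%R;
  banach_mulDr : right_distributive banach_mul +%R;
  banach_scaleAl : forall (a : K) x y,
    a *: banach_mul x y = banach_mul (a *: x) y;
  banach_scaleAr : forall (a : K) x y,
    a *: banach_mul x y = banach_mul x (a *: y);
  banach_norm1 : `|banach_one| = 1;
  banach_normM : forall x y, `|banach_mul x y| <= `|x| * `|y|
}.

Definition banach_sort (K : numFieldType) (A : unitalBanachAlgType K) : Type :=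
  banach_space A.
Coercion banach_sort : unitalBanachAlgType >-> Sortclass.

Section banach_algebra_instances.
Variables (K : numFieldType) (A : unitalBanachAlgType K).

HB.instance Definition _ :=
  CompleteNormedModule.copy (banach_sort A) (banach_space A).

Lemma banach_one_neq0 : banach_one A != 0.
Proof. by rewrite -normr_eq0 banach_norm1 oner_neq0. Qed.

HB.instance Definition _ := GRing.Zmodule_isNzRing.Build (banach_sort A)
  (@banach_mulA K A) (@banach_mul1l K A) (@banach_mul1r K A)
  (@banach_mulDl K A) (@banach_mulDr K A) banach_one_neq0.

HB.instance Definition _ :=
  GRing.Lmodule_isLalgebra.Build K (banach_sort A) (@banach_scaleAl K A).

HB.instance Definition _ :=
  GRing.Lalgebra_isAlgebra.Build K (banach_sort A) (@banach_scaleAr K A).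

End banach_algebra_instances.

Definition contractive (K : numFieldType) (V W : normedModType K)
    (f : V -> W) : Prop :=
  forall x, `|f x| <= `|x|.

(* Not [{lrmorphism A -> A}]: an endomorphism need not preserve the unit. *)
Definition algebra_endomorphism (K : numFieldType) (A : algType K)
    (f : A -> A) : Prop :=
  linear f /\ {morph f : x y / x * y}.

Record bounded_op (K : numFieldType) (E : normedModType K) : Type := BoundedOp {
  bounded_op_fun :> E -> E;
  bounded_op_linear : linear bounded_op_fun;
  bounded_op_continuous : continuous bounded_op_fun
}.

HB.instance Definition _ (K : numFieldType) (E : normedModType K)
    (f : bounded_op E) :=
  GRing.isLinear.Build K E E *:%R (bounded_op_fun f) (bounded_op_linear f).

Section bounded_op_algebra.
Variables (K : numFieldType) (E : normedModType K).
Local Notation B := (bounded_op E).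
Implicit Types f g : B.

HB.instance Definition _ := gen_eqMixin B.
HB.instance Definition _ := gen_choiceMixin B.

Lemma bounded_opP f g : (f : E -> E) =1 g -> f = g.
Proof.
case: f g => [f lf cf] [g lg cg] /= /funext fg.
case: _ / fg lg cg => lg cg.
by congr BoundedOp; exact: Prop_irrelevance.
Qed.

Lemma bounded_op_add_continuous f g : continuous (f \+ g).
Proof. by move=> x; apply: cvgD; exact: bounded_op_continuous. Qed.

Lemma bounded_op_opp_continuous f : continuous (\- f).
Proof. by move=> x; apply: cvgN; exact: bounded_op_continuous. Qed.

Lemma bounded_op_zero_continuous : continuous (\0 : E -> E).
Proof. by move=> x; exact: cvg_cst. Qed.

Lemma bounded_op_scale_continuous (a : K) f : continuous (a \*: f).
Proof. by move=> x; apply: cvgZr; exact: bounded_op_continuous. Qed.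

Lemma bounded_op_one_continuous : continuous (idfun : E -> E).
Proof. by move=> x; exact: cvg_id. Qed.

Lemma bounded_op_mul_continuous f g : continuous (f \o g).
Proof. by move=> x; apply: continuous_comp; exact: bounded_op_continuous. Qed.

Definition bounded_op_zero : B :=
  BoundedOp (linearP \0) bounded_op_zero_continuous.
Definition bounded_op_opp f : B :=
  BoundedOp (linearP (\- f)) (@bounded_op_opp_continuous f).
Definition bounded_op_add f g : B :=
  BoundedOp (linearP (f \+ g)) (@bounded_op_add_continuous f g).
Definition bounded_op_scale a f : B :=
  BoundedOp (linearP (a \*: f)) (@bounded_op_scale_continuous a f).
Definition bounded_op_one : B :=
  BoundedOp (linearP idfun) bounded_op_one_continuous.
Definition bounded_op_mul f g : B :=
  BoundedOp (linearP (f \o g)) (@bounded_op_mul_continuous f g).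

Lemma bounded_op_addA : associative bounded_op_add.
Proof. by move=> f g h; apply: bounded_opP => x /=; rewrite addrA. Qed.
Lemma bounded_op_addC : commutative bounded_op_add.
Proof. by move=> f g; apply: bounded_opP => x /=; rewrite addrC. Qed.
Lemma bounded_op_add0 : left_id bounded_op_zero bounded_op_add.
Proof. by move=> f; apply: bounded_opP => x /=; rewrite add0r. Qed.
Lemma bounded_op_addN :
  left_inverse bounded_op_zero bounded_op_opp bounded_op_add.
Proof. by move=> f; apply: bounded_opP => x /=; rewrite addNr. Qed.

HB.instance Definition _ := GRing.isZmodule.Build B
  bounded_op_addA bounded_op_addC bounded_op_add0 bounded_op_addN.

Lemma bounded_op_mulA : associative bounded_op_mul.
Proof. by move=> f g h; apply: bounded_opP. Qed.
Lemma bounded_op_mul1 : left_id bounded_op_one bounded_op_mul.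
Proof. by move=> f; apply: bounded_opP. Qed.
Lemma bounded_op_mulr1 : right_id bounded_op_one bounded_op_mul.
Proof. by move=> f; apply: bounded_opP. Qed.
Lemma bounded_op_mulDl : left_distributive bounded_op_mul +%R.
Proof. by move=> f g h; apply: bounded_opP. Qed.
Lemma bounded_op_mulDr : right_distributive bounded_op_mul +%R.
Proof. by move=> f g h; apply: bounded_opP => x /=; rewrite linearD. Qed.

(* Only a [pzRingType]: the zero space has a zero operator algebra. *)
HB.instance Definition _ := GRing.Zmodule_isPzRing.Build B
  bounded_op_mulA bounded_op_mul1 bounded_op_mulr1
  bounded_op_mulDl bounded_op_mulDr.

Lemma bounded_op_scaleA a b f :
  bounded_op_scale a (bounded_op_scale b f) = bounded_op_scale (a * b) f.
Proof. by apply: bounded_opP => x /=; rewrite scalerA. Qed.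
Lemma bounded_op_scale1 : left_id 1 bounded_op_scale.
Proof. by move=> f; apply: bounded_opP => x /=; rewrite scale1r. Qed.
Lemma bounded_op_scaleDr : right_distributive bounded_op_scale +%R.
Proof. by move=> a f g; apply: bounded_opP => x /=; rewrite scalerDr. Qed.
Lemma bounded_op_scaleDl f : {morph bounded_op_scale^~ f : a b / a + b}.
Proof. by move=> a b; apply: bounded_opP => x /=; rewrite scalerDl. Qed.

HB.instance Definition _ := GRing.Zmodule_isLmodule.Build K B
  bounded_op_scaleA bounded_op_scale1 bounded_op_scaleDr bounded_op_scaleDl.

End bounded_op_algebra.

Notation "''B' ( E )" := (bounded_op E) (at level 8, format "''B' ( E )").

Section operators.
Variables (K : numFieldType) (E : normedModType K).
Implicit Types (T S W : 'B(E)) (M : set 'B(E)).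

Definition opnorm T : K :=
  supremum 0 [set `|T x| | x in [set x : E | `|x| <= 1]].

Definition mutually_adjoint_partial_isometries T S : Prop :=
  [/\ contractive T, contractive S, T * S * T = T & S * T * S = S].

Definition commutant M : set 'B(E) := [set T | forall m, M m -> T * m = m * T].

Definition unital_subalgebra M : Prop :=
  [/\ M 1,
      forall (a : K) T S, M T -> M S -> M (a *: T + S)
    & forall T S, M T -> M S -> M (T * S)].

(* [W = b T] with [b] in [M], where [T] and [S] implement the endomorphism
   [beta] of [M]; the values of [beta] outside [M] are irrelevant. *)
Definition abstract_weighted_shift M (beta : 'B(E) -> 'B(E)) T S W : Prop :=
  [/\ unital_subalgebra M,
      mutually_adjoint_partial_isometries T S,
      (forall b, M b -> M (T * b * S)) /\ commutant M (S * T),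
      forall b, M b -> beta b = T * b * S
    & exists2 b, M b & W = b * T].

End operators.

Lemma scalars_supremums (R : realType) (k : scalar_kind)
    (X : set (scalars R k)) (M : scalars R k) :
  X 0 -> (forall x, X x -> 0 <= x <= M) -> supremums X !=set0.
Proof.
case: k X M => /= X M X0 XM.
  have hs : has_sup X.
    by split; [exists 0 | exists M => x /XM /andP[]].
  exists (sup X); split; first exact/ubP/sup_upper_bound.
  by move=> y /= Xy; apply: ge_sup => //; exists 0.
pose Y : set R := [set complex.Re x | x in X].
have hs : has_sup Y.
  split; first by exists 0, 0.
  exists (complex.Re M) => _ [x /XM /andP[_ +] <-].
  by rewrite lecE => /andP[_].
exists (sup Y)%:C%C; split.
  move=> x Xx; have /andP[+ _] := XM _ Xx; rewrite !lecE /= => /andP[/eqP <- _].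
  by rewrite eqxx /=; apply: sup_upper_bound => //; exists x.
move=> y Xy; have := Xy _ X0; rewrite !lecE /= => /andP[/eqP -> _].
rewrite eqxx /=; apply: ge_sup; first by exists 0, 0.
by move=> _ [x Xx <-]; have := Xy _ Xx; rewrite lecE => /andP[].
Qed.

(* [supremum] returns a default value when there is no least upper bound;
   for operators this never happens. *)
Lemma opnorm_supremums (R : realType) (k : scalar_kind)
    (E : normedModType (scalars R k)) (T : 'B(E)) :
  supremums [set `|T x| | x in [set x : E | `|x| <= 1]] (opnorm T).
Proof.
set X := [set _ | _ in _].
have X0 : X 0 by exists 0; rewrite /= ?linear0 ?normr0 ?ler01.
have [M XM] : exists M, forall x : E, `|x| <= 1 -> `|T x| <= M.
  apply: ((bounded_funP T).2 _ 1); apply/linear_bounded_continuous.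
  exact: bounded_op_continuous.
have [s sX] : supremums X !=set0.
  apply: (@scalars_supremums _ _ _ M) => // _ [x /= x1 <-].
  by rewrite normr_ge0 XM.
rewrite /opnorm -/X /supremum ifF; last by apply/negbTE/set0P; exists 0.
exact: (xgetI _ sX).
Qed.

(* Main.v *)
(* Let E be the space of bounded sequences (x_n) in A with
   alpha^n(1) x_n = x_n, under the sup norm. The constraint makes the diagonal
   representation pi(a) x = (alpha^n(a) x_n) unital although alpha(1) need not
   be 1, and pi is isometric because the sequence (alpha^n(1)) is a unit vector
   of E whose image has a as its term at n = 0. T is the backward shift; S is
   the forward shift cut down to E, (S x)_(n+1) = alpha^(n+1)(1) x_n. Hence
   T pi(a) S = pi(alpha(a)), and S T only erases the term at n = 0, so it
   commutes with the diagonal operators pi(a). *)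
Require Import Defs.
From HB Require Import structures.
From mathcomp Require Import all_boot all_order all_algebra.
From mathcomp Require Import all_classical all_reals all_analysis.

Set Implicit Arguments.
Unset Strict Implicit.
Unset Printing Implicit Defensive.

Import Order.TTheory GRing.Theory Num.Theory.
Import numFieldNormedType.Exports.

Local Open Scope classical_set_scope.
Local Open Scope ring_scope.

(** * Operators with a linear bound, and norms that are attained *)

Section linear_bound.
Variables (K : numFieldType) (E : normedModType K) (f : E -> E) (c : K).
Hypotheses (f_lin : linear f) (f_le : forall x, `|f x| <= c * `|x|).

Lemma linear_le_continuous : continuous f.
Proof.
pose fL := GRing.isLinear.Build K E E *:%R f f_lin.
pose g : {linear E -> E} := HB.pack f fL.
have -> : f = g by [].
apply/linear_bounded_continuous/bounded_funP => r.
(* The sign of [c] is unknown, even its being real, when [E] is zero, hence the absolute value;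
   [c * |x|] itself is real because it dominates a norm. *)
exists (`|c| * r) => x xr.
apply: le_trans (f_le x) _; apply: le_trans (real_ler_norm _) _.
  by rewrite ger0_real// (le_trans _ (f_le x)).
by rewrite normrM normr_id ler_wpM2l.
Qed.

Definition bounded_op_of_le : 'B(E) := BoundedOp f_lin linear_le_continuous.

End linear_bound.

Lemma opnormP (R : realType) (k : scalar_kind)
    (E : normedModType (scalars R k)) (T : 'B(E)) (c : scalars R k) :
  (forall x, `|T x| <= c * `|x|) ->
  (exists2 x : E, `|x| <= 1 & `|T x| = c) -> opnorm T = c.
Proof.
move=> Tc [x x1 Tx]; have [ub lb] := opnorm_supremums T.
apply/eqP; rewrite eq_le; apply/andP; split.
  apply: lb => _ [y /= y1 <-]; rewrite (le_trans (Tc y))// ler_piMr//.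
  by rewrite -Tx.
by rewrite -Tx; apply: ub; exists x.
Qed.

(** * The Banach space of bounded sequences with fixed terms *)

Section fixed_sequences.
Variables (R : realType) (k : scalar_kind).
Let K := scalars R k.
Variables (V : completeNormedModType K) (p : nat -> 'B(V)).

(** Linearity of each [p n] makes this a subspace, and continuity makes it closed under termwise
    limits. For the shifts, [p n] will be left multiplication by alpha^n(1). *)
Definition fixed_bounded : {pred nat -> V} := fun x =>
  `[< (exists M, forall n, `|x n| <= M) /\ forall n, p n (x n) = x n >].

Lemma fixed_bounded_submod_closed : submod_closed fixed_bounded.
Proof.
split=> [|a x y /asboolP[[M xM] px] /asboolP[[N yN] py]]; apply/asboolP.
  by split=> [|n]; [exists 0 => n; rewrite normr0 | exact: linear0].
split=> [|n]; last first.
  by rewrite [LHS]bounded_op_linear px py.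
exists (`|a| * M + N) => n.
by rewrite (le_trans (ler_normD _ _))// lerD// normrZ ler_wpM2l.
Qed.

HB.instance Definition _ := GRing.isSubmodClosed.Build K (nat -> V)
  fixed_bounded fixed_bounded_submod_closed.

Record fixed_linfty := FixedLinfty {
  linfty_seq :> nat -> V;
  linfty_seqP : linfty_seq \in fixed_bounded
}.

HB.instance Definition _ := [isSub for linfty_seq].
HB.instance Definition _ := [Choice of fixed_linfty by <:].
HB.instance Definition _ := [SubChoice_isSubLmodule of fixed_linfty by <:].

Implicit Types x y : fixed_linfty.

Lemma linfty_eqP x y : (forall n, x n = y n) -> x = y.
Proof. by move=> xy; apply/val_inj/funext. Qed.

Lemma linfty_fixed x n : p n (x n) = x n.
Proof. by have /asboolP[_] := linfty_seqP x. Qed.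

Lemma fixed_boundedI (u : nat -> V) (M : K) :
  (forall n, `|u n| <= M) -> (forall n, p n (u n) = u n) ->
  u \in fixed_bounded.
Proof. by move=> uM pu; apply/asboolP; split=> //; exists M. Qed.

(* Adding [0] does not change the supremum of these nonnegative numbers, but
   [scalars_supremums] requires it. *)
Definition linfty_norm x : K :=
  supremum 0 (0 |` range (fun n => `|x n|)).

Lemma linfty_norm_supremums x :
  supremums (0 |` range (fun n => `|x n|)) (linfty_norm x).
Proof.
have /asboolP[[M xM] _] := linfty_seqP x.
rewrite /linfty_norm /supremum ifF; last by apply/negbTE/set0P; exists 0; left.
suff [s xs] : supremums (0 |` range (fun n => `|x n|)) !=set0.
  exact: (xgetI _ xs).
apply: (@scalars_supremums _ _ _ M); first by left.
move=> _ [->|[n _ <-]]; last by rewrite normr_ge0 xM.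
by rewrite lexx (le_trans _ (xM 0)).
Qed.

Lemma linfty_norm_ub x n : `|x n| <= linfty_norm x.
Proof.
by have [ub _] := linfty_norm_supremums x; apply: ub; right; exists n.
Qed.

Lemma linfty_norm_ge0 x : 0 <= linfty_norm x.
Proof. exact: le_trans (linfty_norm_ub x 0). Qed.

Lemma linfty_norm_le x (M : K) : (forall n, `|x n| <= M) -> linfty_norm x <= M.
Proof.
move=> xM; have [_ lb] := linfty_norm_supremums x; apply: lb.
by move=> _ [->|[n _ <-]] //; exact: le_trans (xM 0).
Qed.

Lemma linfty_normD x y :
  linfty_norm (x + y) <= linfty_norm x + linfty_norm y.
Proof.
apply: linfty_norm_le => n.
by rewrite (le_trans (ler_normD _ _))// lerD// linfty_norm_ub.
Qed.

Lemma linfty_normZ (a : K) x : linfty_norm (a *: x) = `|a| * linfty_norm x.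
Proof.
have leZ b y : linfty_norm (b *: y) <= `|b| * linfty_norm y.
  by apply: linfty_norm_le => n; rewrite normrZ ler_wpM2l// linfty_norm_ub.
apply/eqP; rewrite eq_le leZ /=; have [->|a0] := eqVneq a 0.
  by rewrite normr0 mul0r linfty_norm_ge0.
(* The reverse inequality is [leZ] for the scalar [a^-1] and the vector [a *: x]. *)
rewrite -ler_pdivlMl ?normr_gt0// -normfV.
by rewrite -{1}[x](scalerK a0) leZ.
Qed.

Lemma linfty_norm_eq0 x : linfty_norm x = 0 -> x = 0.
Proof.
move=> x0; apply: linfty_eqP => n; apply/eqP.
by rewrite -normr_le0 -x0 linfty_norm_ub.
Qed.

HB.instance Definition _ := Lmodule_isNormed.Build K fixed_linfty
  linfty_normD linfty_normZ linfty_norm_eq0.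

Lemma linfty_ub x n : `|x n| <= `|x|.
Proof. exact: linfty_norm_ub. Qed.

Lemma linfty_le x (M : K) : (forall n, `|x n| <= M) -> `|x| <= M.
Proof. exact: linfty_norm_le. Qed.

(** Coordinates are 1-Lipschitz, so [F] converges termwise to some [l]; the Cauchy estimates pass to
    the limit with a bound independent of the index, so the convergence is uniform. *)
Lemma linfty_complete (F : set_system fixed_linfty) :
  ProperFilter F -> cauchy F -> cvg F.
Proof.
move=> FF /cauchyP Fc.
have Fcn n : cauchy ((fun x : fixed_linfty => x n) @ F).
  apply: cauchy_exP => e e0; have [x Fx] := Fc _ e0.
  exists (x n); apply: (filterS _ Fx : F [set y | ball (x n) e (y n)]) => y.
  rewrite -!ball_normE /=.
  by apply: le_lt_trans; exact: (linfty_ub (x - y)).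
have Fn n : exists l : V, (fun x : fixed_linfty => x n) @ F --> l.
  by apply/cvg_ex; exact: (cauchy_cvg _ (Fcn n)).
have [l lF] := choice Fn.
have near_l x e : F (ball x e) -> forall n, `|x n - l n| <= e.
  move=> Fx n; apply/ler_addgt0Pr => d d0.
  have /cvgrPdist_lt/(_ _ d0) Fl := lF n.
  (* The auxiliary [y] may depend on [n] and [d]; the resulting bound [e] does not. *)
  have [y [xy ly]] := filter_ex (filterI Fx Fl).
  rewrite (le_trans (ler_distD (y n) _ _))// lerD//; last first.
    by rewrite distrC ltW.
  move: xy; rewrite -ball_normE /= => /ltW; apply: le_trans.
  exact: (linfty_ub (x - y)).
have lin : l \in fixed_bounded.
  have [x Fx] := Fc 1 ltr01.
  apply: (@fixed_boundedI _ (`|x| + 1)) => n.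
    rewrite -[l n](subKr (x n)) (le_trans (ler_normB _ _))//.
    by rewrite lerD ?linfty_ub ?near_l.
  (* The same function of [x] tends to both [p n (l n)] and [l n], so these agree. *)
  have pl : (fun x : fixed_linfty => p n (x n)) @ F --> p n (l n).
    apply: (cvg_comp _ _ (lF n)); exact: bounded_op_continuous.
  have pE : (fun x : fixed_linfty => p n (x n)) = (fun x => x n).
    by apply/funext => y; exact: linfty_fixed.
  by rewrite pE in pl; exact: (cvg_unique _ pl (lF n)).
apply/cvg_ex; exists (FixedLinfty lin); apply/fcvg_ballP => e e0.
(* [near_l] is not strict; strictness comes from the other half, the distance from [x] to [y]. *)
have [x Fx] := Fc _ (divr_gt0 e0 (ltr0n K 2)).
apply: filterS (Fx) => y; rewrite -!ball_normE /= => xy.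
apply: le_lt_trans (ler_distD x _ _) _; rewrite [ltRHS]splitr ler_ltD//.
by rewrite distrC; apply: linfty_le => n; exact: near_l.
Qed.

HB.instance Definition _ := Uniform_isComplete.Build fixed_linfty
  linfty_complete.

End fixed_sequences.

(** * Iterates of the endomorphism and the space they define *)

Section shift_representation.
Variables (R : realType) (k : scalar_kind).
Let K := scalars R k.
Variables (A : unitalBanachAlgType K) (alpha : A -> A).
Hypotheses (alpha_endo : algebra_endomorphism alpha).
Hypotheses (alpha_contr : contractive alpha).

Lemma iter_endo_linear n : linear (iter n alpha).
Proof. by elim: n => // n IHn a x y; rewrite !iterS IHn alpha_endo.1. Qed.

Lemma iter_endoM n : {morph iter n alpha : x y / x * y}.
Proof. by elim: n => // n IHn x y; rewrite !iterS IHn alpha_endo.2. Qed.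

Lemma iter_endo_contractive n : contractive (iter n alpha).
Proof. by elim: n => //= n IHn x; exact: le_trans (alpha_contr _) (IHn x). Qed.

Lemma iter_endo1_le1 n : `|iter n alpha 1| <= 1 :> K.
Proof. by rewrite (le_trans (iter_endo_contractive _ _))// banach_norm1. Qed.

Lemma lmul_linear (a : A) : linear (fun x : A => a * x).
Proof. by move=> c x y; rewrite mulrDr scalerAr. Qed.

Definition lmul_op (a : A) : 'B(A) :=
  bounded_op_of_le (lmul_linear a) (banach_normM a).

Definition shift_space : completeNormedModType K :=
  fixed_linfty (fun n => lmul_op (iter n alpha 1)).

Lemma shift_space_fixed (x : shift_space) n : iter n alpha 1 * x n = x n.
Proof. exact: (linfty_fixed x n). Qed.

(** * The isometric diagonal representation *)

Lemma diag_subproof (a : A) (x : shift_space) :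
  (fun n => iter n alpha a * x n)
    \in fixed_bounded (fun n => lmul_op (iter n alpha 1)).
Proof.
apply: (@fixed_boundedI _ _ _ _ _ (`|a| * `|x|)) => n.
  rewrite (le_trans (banach_normM _ _))// ler_pM//.
    exact: iter_endo_contractive.
  exact: linfty_ub.
(* Multiplicativity absorbs the idempotent: alpha^n(1) alpha^n(a) = alpha^n(1 a). *)
by rewrite /= mulrA -iter_endoM mul1r.
Qed.

Definition diag_fun (a : A) (x : shift_space) : shift_space :=
  FixedLinfty (diag_subproof a x).

Lemma diag_linear a : linear (diag_fun a).
Proof.
move=> c x y; apply: linfty_eqP => n.
exact: (lmul_linear (iter n alpha a) c (x n) (y n)).
Qed.

Lemma diag_le a (x : shift_space) : `|diag_fun a x| <= `|a| * `|x|.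
Proof.
apply: linfty_le => n; rewrite (le_trans (banach_normM _ _))// ler_pM//.
  exact: iter_endo_contractive.
exact: linfty_ub.
Qed.

Definition diag (a : A) : 'B(shift_space) :=
  bounded_op_of_le (diag_linear a) (diag_le a).

Lemma diag_is_linear : linear diag.
Proof.
move=> c a b; apply: bounded_opP => x; apply: linfty_eqP => n.
by rewrite [LHS]/= iter_endo_linear mulrDl -scalerAl.
Qed.

Lemma diag_is_monoid_morphism : monoid_morphism diag.
Proof.
split=> [|a b]; apply: bounded_opP => x; apply: linfty_eqP => n /=.
  exact: shift_space_fixed.
by rewrite iter_endoM mulrA.
Qed.

HB.instance Definition _ :=
  GRing.isLinear.Build K A 'B(shift_space) *:%R diag diag_is_linear.
HB.instance Definition _ :=
  GRing.isMonoidMorphism.Build A 'B(shift_space) diag diag_is_monoid_morphism.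

Lemma shift_space_unit_subproof :
  (fun n => iter n alpha 1)
    \in fixed_bounded (fun n => lmul_op (iter n alpha 1)).
Proof.
apply: (@fixed_boundedI _ _ _ _ _ 1) => n; first exact: iter_endo1_le1.
by rewrite /= -iter_endoM mul1r.
Qed.

Lemma diag_isometric a : opnorm (diag a) = `|a|.
Proof.
apply: opnormP; first exact: diag_le.
pose u : shift_space := FixedLinfty shift_space_unit_subproof.
have u1 : `|u| <= 1 by apply: linfty_le => n; exact: iter_endo1_le1.
exists u => //; apply/eqP; rewrite eq_le; apply/andP; split.
  by rewrite (le_trans (diag_le _ _))// ler_piMr.
by have := linfty_ub (diag a u) 0; rewrite /= mulr1.
Qed.

(** * Backward and forward shifts *)

Lemma bshift_subproof (x : shift_space) :
  (fun n => x n.+1) \in fixed_bounded (fun n => lmul_op (iter n alpha 1)).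
Proof.
apply: (@fixed_boundedI _ _ _ _ _ `|x|) => n; first exact: (linfty_ub x n.+1).
(* The idempotents decrease: alpha^n(1) alpha^(n+1)(1) = alpha^n(1 alpha(1)) = alpha^(n+1)(1), so a
   term fixed by the later one is fixed by the earlier. *)
rewrite -[x n.+1](shift_space_fixed x n.+1) [LHS]mulrA iterSr.
by rewrite -iter_endoM mul1r.
Qed.

Definition bshift_fun (x : shift_space) : shift_space :=
  FixedLinfty (bshift_subproof x).

Lemma bshift_linear : linear bshift_fun.
Proof. by move=> c x y; apply: linfty_eqP. Qed.

Lemma bshift_le (x : shift_space) : `|bshift_fun x| <= 1 * `|x|.
Proof. by rewrite mul1r; apply: linfty_le => n; exact: (linfty_ub x n.+1). Qed.

Definition bshift : 'B(shift_space) := bounded_op_of_le bshift_linear bshift_le.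

(** The factor has the target index [n = m.+1]: [x m] is known to be fixed by alpha^m(1), whereas
    position [n] requires the smaller idempotent. *)
Definition fshift_seq (x : shift_space) (n : nat) : A :=
  if n is m.+1 then iter n alpha 1 * x m else 0.

Lemma fshift_seq_le x n : `|fshift_seq x n| <= `|x|.
Proof.
case: n => [|n]; rewrite /fshift_seq; first by rewrite normr0.
rewrite (le_trans (banach_normM _ _))// -[leRHS]mul1r ler_pM//.
  exact: iter_endo1_le1.
exact: linfty_ub.
Qed.

Lemma fshift_subproof (x : shift_space) :
  fshift_seq x \in fixed_bounded (fun n => lmul_op (iter n alpha 1)).
Proof.
apply: (@fixed_boundedI _ _ _ _ _ `|x|); first exact: fshift_seq_le.
case=> [|n]; first exact: mulr0.
by rewrite /fshift_seq [LHS]mulrA -iter_endoM mul1r.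
Qed.

Definition fshift_fun (x : shift_space) : shift_space :=
  FixedLinfty (fshift_subproof x).

Lemma fshift_linear : linear fshift_fun.
Proof.
move=> c x y; apply: linfty_eqP => -[|n].
  (* At index 0 the claim is 0 = c 0 + 0. *)
  by rewrite [LHS]/= -[LHS](scaler0 _ c) -[LHS]addr0.
exact: (lmul_linear (iter n.+1 alpha 1) c (x n) (y n)).
Qed.

Lemma fshift_le (x : shift_space) : `|fshift_fun x| <= 1 * `|x|.
Proof. by rewrite mul1r; apply: linfty_le => n; exact: fshift_seq_le. Qed.

Definition fshift : 'B(shift_space) := bounded_op_of_le fshift_linear fshift_le.

(** * Relations between the shifts and the representation *)

Lemma shift_partial_isometries :
  mutually_adjoint_partial_isometries bshift fshift.
Proof.
split=> [x|x||].
- by have := bshift_le x; rewrite mul1r.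
- by have := fshift_le x; rewrite mul1r.
- apply: bounded_opP => x; apply: linfty_eqP => n.
  (* [bshift * fshift] multiplies term [n] by alpha^(n+1)(1), which fixes term [n] of [bshift x]. *)
  exact: (shift_space_fixed x n.+1).
- apply: bounded_opP => x; apply: linfty_eqP => -[|n] //.
  (* Here alpha^(n+1)(1) meets a term of [fshift x], already cut down by it. *)
  exact: (shift_space_fixed (fshift x) n.+1).
Qed.

Lemma diag_endo a : diag (alpha a) = bshift * diag a * fshift.
Proof.
apply: bounded_opP => x; apply: linfty_eqP => n /=.
(* The right side is alpha^(n+1)(a) alpha^(n+1)(1) x_n, where the idempotent is absorbed; the left
   is alpha^n(alpha(a)) x_n. *)
rewrite -/(iter n.+1 alpha a) -/(iter n.+1 alpha 1).
by rewrite mulrA -iter_endoM mulr1 iterSr.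
Qed.

Lemma shift_commutes : commutant (range diag) (fshift * bshift).
Proof.
move=> _ [a _ <-]; apply: bounded_opP => x; apply: linfty_eqP => -[|n] /=.
  by rewrite mulr0.
(* At positive indices alpha^(n+1)(1) disappears on both sides: on one it fixes the term of [x], on
   the other alpha^(n+1)(a) absorbs it. *)
rewrite -!/(iter n.+1 alpha _) (shift_space_fixed x n.+1).
by rewrite mulrA -iter_endoM mul1r.
Qed.

End shift_representation.

Theorem proposition2p17 (R : realType) (k : scalar_kind)
    (A : unitalBanachAlgType (scalars R k)) (alpha : A -> A)
    (alpha_endo : algebra_endomorphism alpha)
    (alpha_contr : contractive alpha) :
  exists (E : completeNormedModType (scalars R k))
         (pi : {lrmorphism A -> 'B(E)}) (S T : 'B(E)),
    [/\ forall a, opnorm (pi a) = `|a|,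
        mutually_adjoint_partial_isometries T S,
        forall a, pi (alpha a) = T * pi a * S,
        commutant (range pi) (S * T)
      & exists2 beta : 'B(E) -> 'B(E),
          forall a, beta (pi a) = pi (alpha a)
        & forall a, abstract_weighted_shift (range pi) beta T S (pi a * T)].
Proof.
pose pi : {lrmorphism A -> 'B(shift_space alpha)} :=
  diag alpha_endo alpha_contr.
pose T := bshift alpha_endo; pose S := fshift alpha_endo alpha_contr.
have TS := shift_partial_isometries alpha_endo alpha_contr.
have piE := diag_endo alpha_endo alpha_contr.
have ST := @shift_commutes _ _ _ _ alpha_endo alpha_contr.
exists (shift_space alpha), pi, S, T; split=> //.
  exact: diag_isometric.
exists (fun b => T * b * S) => [a|a]; first by rewrite -piE.
split=> //; last by exists (pi a) => //; exists a.
- split; first by exists 1 => //; exact: rmorph1.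
    move=> c _ _ [b _ <-] [d _ <-].
    by exists (c *: b + d) => //; exact: linearP.
  by move=> _ _ [b _ <-] [d _ <-]; exists (b * d) => //; exact: rmorphM.
(* The range is stable because compressing [pi b] gives [pi (alpha b)]. *)
- by split=> // _ [b _ <-]; exists (alpha b) => //; exact: piE.
Qed.
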